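(* There exist constants $0<c_0\le c_1$, $c_2,c_3,\gamma_0>0$ and a constant $c>0$ such that for every positive integer $T$ and every adaptive experimental design $\mathcal D$ there exists a deterministic sequence $\{y_t(1),y_t(0),x_t\}_{t=1}^T$ satisfying Assumptions 1, 2 and 3 with constants $c_0,c_1,c_2,c_3,\gamma_0$, under which the Neyman regret of $\mathcal D$ satisfies $$\mathcal R^{\mathrm{Neyman}}_T\ge c\cdot T^{-1/2}R,\qquad R=\max_{t\in[T]}\|x_t\|.$$
   Context: **Setting.** Let $T\ge1$, $[T]=\{1,\dots,T\}$. The data are deterministic: covariates $x_t\in\mathbb R^d$ and potential outcomes $y_t(1),y_t(0)\in\mathbb R$ for $t\in[T]$. In round $t$ a random treatment $Z_t\in\{0,1\}$ is assigned and $Y_t=y_t(Z_t)$ is observed; treatment assignment is the only randomness. $\mathcal F_t=\sigma(Z_1,\dots,Z_t)$. An adaptive experimental design $\mathcal D=\{D_t\}_{t=1}^T$ is a sequence of maps $D_t:(\{0,1\}\times\mathbb R^d\times\mathbb R)^{t-1}\times\mathbb R^d\to[0,1]\times\mathbb R^d\times\mathbb R^d$ specifying $(p_t,\beta_t(1),\beta_t(0))=D_t(Z_1,x_1,Y_1,\dots,Z_{t-1},x_{t-1},Y_{t-1},x_t)$, where $p_t=\Pr(Z_t=1\mid\mathcal F_{t-1})$. A design is a procedure applicable to covariates of any dimension $d\ge1$ (the dimension $d$ is part of the sequence of data), and is taken to have $p_t\in(0,1)$ so that the estimator below is defined. The adaptive AIPW estimator is $$\hat\tau=\frac1T\sum_{t=1}^T\Big\{\langle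 x_t,\beta_t(1)\rangle-\langle x_t,\beta_t(0)\rangle+\frac{\mathbf 1[Z_t=1]}{p_t}(Y_t-\langle x_t,\beta_t(1)\rangle)-\frac{\mathbf 1[Z_t=0]}{1-p_t}(Y_t-\langle x_t,\beta_t(0)\rangle)\Big\}.$$ **Neyman regret.** The oracle variance is $V^*=\min_{p\in(0,1),\,\beta(1),\beta(0)\in\mathbb R^d}\mathrm{Var}(\hat\tau;p,\beta(1),\beta(0))$, where $\mathrm{Var}(\hat\tau;p,\beta(1),\beta(0))$ is the variance of $\hat\tau$ under the non-adaptive design $p_t=p$, $\beta_t(k)=\beta(k)$ for all $t$. The Neyman regret of a design is $\mathcal R^{\mathrm{Neyman}}_T=T\,\mathrm{Var}(\hat\tau)-T\,V^*$. **Assumption 1 (constants $0<c_0\le c_1$).** For both $k\in\{0,1\}$: $c_0\le\min_{\beta\in\mathbb R^d}\big(\frac1T\sum_{t=1}^T(y_t(k)-\langle x_t,\beta\rangle)^2\big)^{1/2}\le\big(\frac1T\sum_{t=1}^Ty_t(k)^4\big)^{1/4}\le c_1$. **Assumption 2 (constants $c_2,\gamma_0>0$).** For all $t\in[T]$ with $t\ge T^{1/2}\gamma_0$: $\sigma_{\min}\big(\frac1t\sum_{s\le t}x_sx_s^{\top}\big)\ge 1/c_2$. **Assumption 3 (constant $c_3>0$).** $R=\max_{t\in[T]}\|x_t\|\le c_3T^{1/4}$. *)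

(* Defs.v *)
From HB Require Import structures.
From mathcomp Require Import all_boot all_order all_algebra.
From mathcomp Require Import all_classical all_reals all_analysis.

Set Implicit Arguments.
Unset Strict Implicit.
Unset Printing Implicit Defensive.

Import Order.TTheory GRing.Theory Num.Theory.

Local Open Scope classical_set_scope.
Local Open Scope ring_scope.

Definition dotv (R : realType) (d : nat) (u v : 'cV[R]_d) : R :=
  \sum_i u i 0 * v i 0.

(* The norm `|u| that MathComp-Analysis puts on matrices is the sup norm. *)
Definition l2norm (R : realType) (d : nat) (u : 'cV[R]_d) : R :=
  Num.sqrt (dotv u u).

(* The infimum is a minimum when 0 < d: A^T A is symmetric, so it has at least
   one and at most d eigenvalues in R. *)
Definition sigma_min (R : realType) (d : nat) (A : 'M[R]_d) : R :=
  inf [set Num.sqrt l | l in [set l : R | eigenvalue (A^T *m A) l]].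

Record decision (R : realType) (d : nat) := Decision {
  treat_prob : R;
  coef : bool -> 'cV[R]_d
}.

(* Rounds are numbered from 0, so that the history available in round t has
   length t. Treatments are booleans, true standing for 1. *)
Definition design (R : realType) (T d : nat) : Type :=
  forall t : 'I_T, t.-tuple (bool * 'cV[R]_d * R) -> 'cV[R]_d -> decision R d.

Definition proper_design (R : realType) (T d : nat) (D : design R T d) : Prop :=
  forall (t : 'I_T) (h : t.-tuple (bool * 'cV[R]_d * R)) (x : 'cV[R]_d),
    0 < treat_prob (D t h x) < 1.

Definition const_design (R : realType) (T d : nat) (p : R)
    (beta : bool -> 'cV[R]_d) : design R T d :=
  fun t h x => Decision p beta.

Section Experiment.
Variables (R : realType) (T d : nat).
Variables (x : 'I_T -> 'cV[R]_d) (y : 'I_T -> bool -> R).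
Implicit Types (D : design R T d) (z : {ffun 'I_T -> bool}) (t : 'I_T).

Definition history z t : t.-tuple (bool * 'cV[R]_d * R) :=
  [tuple (let s' := widen_ord (ltnW (ltn_ord t)) s in
          (z s', x s', y s' (z s'))) | s < t].

Definition decision_at D z t : decision R d := D t (history z t) (x t).

(* The law of (Z_1, ..., Z_T) on {0,1}^T, by the chain rule from
   Pr(Z_t = 1 | F_{t-1}) = p_t. *)
Definition assignment_prob D z : R :=
  \prod_t (if z t then treat_prob (decision_at D z t)
           else 1 - treat_prob (decision_at D z t)).

Definition expect D (f : {ffun 'I_T -> bool} -> R) : R :=
  \sum_z assignment_prob D z * f z.

Definition variance D (f : {ffun 'I_T -> bool} -> R) : R :=
  expect D (fun z => (f z - expect D f) ^+ 2).

Definition tau_hat D z : R :=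
  T%:R^-1 * \sum_t
    let p := treat_prob (decision_at D z t) in
    let m k := dotv (x t) (coef (decision_at D z t) k) in
    let Y := y t (z t) in
    (m true - m false
     + (z t)%:R / p * (Y - m true)
     - (~~ z t)%:R / (1 - p) * (Y - m false)).

Definition var_tau_hat D : R := variance D (tau_hat D).

(* The set is bounded below by 0, and its infimum is attained as soon as no
   potential outcome sequence y(k) lies in the span of the covariates, which
   assumption1 below ensures. *)
Definition oracle_variance : R :=
  inf [set v | exists (p : R) (beta : bool -> 'cV[R]_d),
                 0 < p < 1 /\ v = var_tau_hat (const_design p beta)].

Definition neyman_regret D : R :=
  T%:R * var_tau_hat D - T%:R * oracle_variance.

(* The least-squares minimum over beta is always attained. *)
Definition min_rms_residual (k : bool) : R :=
  inf [set Num.sqrt (T%:R^-1 * \sum_t (y t k - dotv (x t) beta) ^+ 2)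
      | beta in [set: 'cV[R]_d]].

Definition fourth_moment_norm (k : bool) : R :=
  (T%:R^-1 * \sum_t y t k ^+ 4) `^ 4^-1.

Definition assumption1 (c0 c1 : R) : Prop :=
  forall k : bool,
    [/\ c0 <= min_rms_residual k,
        min_rms_residual k <= fourth_moment_norm k
      & fourth_moment_norm k <= c1].

Definition second_moment_mx t : 'M[R]_d :=
  (t.+1%:R)^-1 *: \sum_(s < T | (s <= t)%N) (x s *m (x s)^T).

Definition assumption2 (c2 gamma0 : R) : Prop :=
  forall t, T%:R `^ 2^-1 * gamma0 <= t.+1%:R ->
    c2^-1 <= sigma_min (second_moment_mx t).

Definition max_norm : R := \big[Num.max/0]_t l2norm (x t).

Definition assumption3 (c3 : R) : Prop := max_norm <= c3 * T%:R `^ 4^-1.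

End Experiment.

(* Main.v *)
Require Import Defs.
From mathcomp Require Import all_boot all_order all_algebra.
From mathcomp Require Import all_classical all_reals all_analysis.
From mathcomp Require Import ring lra zify.
Import Order.TTheory GRing.Theory Num.Theory.
Local Open Scope ring_scope.

(** The design commits to its first treatment probability [q] before it has
    seen any outcome, and a single round may carry outcomes of size [T^(1/4)]
    without spoiling the fourth moment bound.  A mistake in that one round
    already costs [T^(-1/2)] of regret.

    The error of the estimator is a sum of martingale differences
    ([tau_hatE], [expect_noiseM]), so its variance is
      [T^(-2) * \sum_t E (((1 - p_t) r_t(1) + p_t r_t(0))^2 / (p_t (1 - p_t)))]
    where [r_t(k)] is the residual of [y_t(k)] ([var_tau_hatE]).  If
    [y_t(k) = a_t * w(k)] for a fixed direction [w] with
    [(1 - p) w(1) + p w(0) = 0], every summand vanishes for the constant design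
    [(p, 0)], so the oracle variance is zero and the regret is [T] times the
    variance of the design ([oracle_variance_le0]).  That is at least the
    contribution of round [0], a nonrandom number because the history is still
    empty ([var_tau_hat_ge]).  The directions [(2, -1)], optimal for [p = 2/3],
    and [(1, -2)], optimal for [p = 1/3], cannot both suit the same [q]
    ([exists_misallocated_direction]).

    Dimension one is enough.  Covariates alternate between [0] and [1], which
    makes the regression problem well conditioned from round two on, keeps half
    of each outcome sequence out of reach of the regression, and, as the first
    covariate is zero, leaves the coefficients of the design without influence
    on round [0] ([hard_regret_ge]).  As [max_norm] is at
    most [1], a regret of [T^(-1/2)] is what the bound asks for. *)

Set Implicit Arguments.
Unset Strict Implicit.
Unset Printing Implicit Defensive.

(** * Functions of the first treatments *)

Section Coordinates.
Variable T : nat.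
Implicit Types (z : {ffun 'I_T -> bool}) (t : 'I_T) (b : bool).

Definition determined_below (A : Type) (m : nat)
    (f : {ffun 'I_T -> bool} -> A) : Prop :=
  forall z z', (forall s : 'I_T, (s < m)%N -> z s = z' s) -> f z = f z'.

Definition put t b z : {ffun 'I_T -> bool} :=
  [ffun s => if s == t then b else z s].

Definition flip t z : {ffun 'I_T -> bool} := put t (~~ z t) z.

Lemma put_same t b z : put t b z t = b.
Proof. by rewrite ffunE eqxx. Qed.

Lemma put_id t z : put t (z t) z = z.
Proof. by apply/ffunP => s; rewrite ffunE; case: eqP => [->|]. Qed.

Lemma flipK t : involutive (flip t).
Proof.
move=> z; apply/ffunP => s; rewrite !ffunE eqxx negbK.
by case: (s =P t) => [->|].
Qed.

Lemma determined_below_le A m n (f : _ -> A) :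
  (m <= n)%N -> determined_below m f -> determined_below n f.
Proof. by move=> mn fm z z' zz'; apply: fm => s /leq_trans/(_ mn)/zz'. Qed.

Lemma determined_below_put A m (f : _ -> A) t b z :
  (m <= t)%N -> determined_below m f -> f (put t b z) = f z.
Proof.
move=> mt; apply=> s sm; rewrite ffunE; case: eqP => // st.
by move: (leq_trans sm mt); rewrite st ltnn.
Qed.

Lemma sum_flip (R : realType) t (f : _ -> R) :
  \sum_z f z = 2^-1 * \sum_z (f z + f (flip t z)).
Proof.
rewrite big_split /=.
have <- : \sum_z f z = \sum_z f (flip t z).
  exact: (reindex_inj (inv_inj (flipK t))).
by field.
Qed.

End Coordinates.

(** * Averaging over the treatments, one round at a time *)

Section Design.
Variables (R : realType) (T d : nat).
Variables (x : 'I_T -> 'cV[R]_d) (y : 'I_T -> bool -> R) (D : design R T d).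
Implicit Types (z : {ffun 'I_T -> bool}) (t : 'I_T) (b : bool).

Local Notation prob z t := (treat_prob (decision_at x y D z t)).

Lemma decision_at_determined t :
  determined_below t (fun z => decision_at x y D z t).
Proof.
move=> z z' zz'; rewrite /decision_at; congr (D _ _).
by apply: eq_from_tnth => s; rewrite !tnth_mktuple /= zz'//=.
Qed.

Lemma decision_at_put t b z :
  decision_at x y D (put t b z) t = decision_at x y D z t.
Proof. exact: determined_below_put (@decision_at_determined t). Qed.

Definition step_prob z t : R := if z t then prob z t else 1 - prob z t.

Lemma step_prob_determined t : determined_below t.+1 (step_prob^~ t).
Proof.
move=> z z' zz'; rewrite /step_prob zz' ?ltnSn//.
rewrite (decision_at_determined (z := z) (z' := z')) => [//|s st].
exact/zz'/ltnW.
Qed.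

(** Expectation when only the first [m] treatments follow the design and the
    later ones are fair coins.  It agrees with [expect] on functions of the
    first [m] treatments, and it keeps the sum over the same index set for
    every [m], so that rounds can be peeled off without truncating [z]. *)
Definition partial_expect (m : nat) (f : {ffun 'I_T -> bool} -> R) : R :=
  2 ^- (T - m) * \sum_z (\prod_(s < T | (s < m)%N) step_prob z s) * f z.

Definition average_at t (f : {ffun 'I_T -> bool} -> R) z : R :=
  prob z t * f (put t true z) + (1 - prob z t) * f (put t false z).

(** Each assignment is paired with the one that differs in round [t] only: the
    factors of the earlier rounds agree, and the two factors of round [t] are
    the weights of [average_at]. *)
Lemma partial_expectS t f :
  partial_expect t.+1 f = partial_expect t (average_at t f).
Proof.
rewrite /partial_expect.
have -> : (2 ^- (T - t) : R) = 2 ^- (T - t.+1) * 2^-1.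
  by rewrite -invfM -exprSr subnSK.
rewrite -mulrA (sum_flip t); congr (_ * (_ * _)); apply: eq_bigr => z _.
pose A z := \prod_(s < T | (s < t)%N) step_prob z s.
have prodS z' : \prod_(s < T | (s < t.+1)%N) step_prob z' s
    = step_prob z' t * A z'.
  rewrite (bigD1 t) ?ltnSn//=; congr (_ * _); apply: eq_bigl => s.
  by rewrite ltnS andbC -val_eqE ltn_neqAle.
have A_det : determined_below t A.
  move=> z1 z2 z12; apply: eq_bigr => s st; apply: step_prob_determined => u us.
  exact/z12/(leq_trans us).
have A_flip : A (flip t z) = A z by apply: determined_below_put A_det.
rewrite !prodS A_flip -/(A z) /average_at.
have -> : f z = f (put t (z t) z) by rewrite put_id.
rewrite /step_prob /flip put_same decision_at_put.
by case: (z t) => /=; ring.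
Qed.

Lemma partial_expect_full f : partial_expect T f = expect x y D f.
Proof.
rewrite /partial_expect subnn expr0 invr1 mul1r; apply: eq_bigr => z _.
by congr (_ * _); apply: eq_bigl => s; rewrite ltn_ord.
Qed.

Lemma expect_partial m f :
  (m <= T)%N -> determined_below m f -> expect x y D f = partial_expect m f.
Proof.
rewrite -partial_expect_full => mT.
have [k] : exists k, (T - m)%N = k by exists (T - m)%N.
elim: k m mT => [|k IHk] m mT /eqP.
  by rewrite subn_eq0 => Tm _; have /eqP-> : m == T by rewrite eqn_leq mT.
move=> /eqP Tmk f_det.
have mT' : (m < T)%N by rewrite -subn_gt0 Tmk.
rewrite (IHk m.+1) //; last exact: determined_below_le f_det.
  2: by rewrite subnS Tmk.
rewrite (partial_expectS (Ordinal mT')); congr (_ * _).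
apply: eq_bigr => z _; congr (_ * _).
by rewrite /average_at !(determined_below_put _ _ _ f_det)//; ring.
Qed.

(** The tower property: [average_at t f] is the conditional expectation of [f]
    given the treatments before round [t]. *)
Lemma expect_average t f : determined_below t.+1 f ->
  expect x y D f = expect x y D (average_at t f).
Proof.
move=> f_det; rewrite (expect_partial _ f_det)// partial_expectS.
rewrite -(expect_partial (ltnW (ltn_ord t)))// => z z' zz'.
rewrite /average_at (decision_at_determined zz').
congr (_ * _ + _ * _); apply: f_det => s; rewrite ltnS leq_eqVlt !ffunE;
  by case/orP=> [/eqP/val_inj-> | st]; rewrite ?eqxx// zz'.
Qed.

Lemma expect1 : expect x y D (fun=> 1) = 1.
Proof.
rewrite (@expect_partial 0)// /partial_expect subn0.
under eq_bigr do rewrite big1 ?mulr1//.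
rewrite sumr_const card_ffun card_bool card_ord natrX.
by rewrite mulVf// expf_neq0// pnatr_eq0.
Qed.

Lemma expectZ a f : expect x y D (fun z => a * f z) = a * expect x y D f.
Proof. by rewrite /expect mulr_sumr; apply: eq_bigr => z _; rewrite mulrCA. Qed.

Lemma expect_cst a : expect x y D (fun=> a) = a.
Proof.
rewrite -[RHS]mulr1 -[in RHS]expect1 -expectZ; congr expect.
by apply/funext => z; rewrite mulr1.
Qed.

Lemma expectD f g :
  expect x y D (fun z => f z + g z) = expect x y D f + expect x y D g.
Proof. by rewrite /expect -big_split; apply: eq_bigr => z _; rewrite mulrDr. Qed.

Lemma expect_sum (I : finType) (f : I -> _ -> R) :
  expect x y D (fun z => \sum_i f i z) = \sum_i expect x y D (f i).
Proof.
rewrite /expect exchange_big; apply: eq_bigr => z _.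
by rewrite mulr_sumr.
Qed.

(** * The estimation error as a sum of martingale differences *)

Hypothesis D_proper : proper_design D.

Lemma assignment_prob_ge0 z : 0 <= assignment_prob x y D z.
Proof.
apply: prodr_ge0 => t _.
have /andP[p0 p1] := D_proper (history x y z t) (x t).
by case: (z t); rewrite ?subr_ge0 ltW.
Qed.

Lemma le_expect f g :
  (forall z, f z <= g z) -> expect x y D f <= expect x y D g.
Proof.
by move=> fg; apply: ler_sum => z _; rewrite ler_wpM2l// assignment_prob_ge0.
Qed.

(** The error of round [t] is this number divided by [p_t] under treatment, and
    its opposite divided by [1 - p_t] under control, so that it alone decides
    how noisy the round is. *)
Definition mixed_residual z t : R :=
  let r k := y t k - dotv (x t) (coef (decision_at x y D z t) k) in
  (1 - prob z t) * r true + prob z t * r false.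

Definition round_noise z t : R :=
  mixed_residual z t * ((z t)%:R - prob z t) / (prob z t * (1 - prob z t)).

Definition average_treatment_effect : R :=
  T%:R^-1 * \sum_t (y t true - y t false).

Lemma tau_hatE z : tau_hat x y D z =
  average_treatment_effect + T%:R^-1 * \sum_t round_noise z t.
Proof.
rewrite /average_treatment_effect -mulrDr -big_split; congr (_ * _).
apply: eq_bigr => t _ /=.
rewrite /round_noise /mixed_residual.
have /andP[p0 p1] := D_proper (history x y z t) (x t).
rewrite -/(decision_at x y D z t) in p0 p1.
have {}p0 : prob z t != 0 by rewrite gt_eqF.
have {}p1 : 1 - prob z t != 0 by rewrite gt_eqF// subr_gt0.
by case: (z t) => /=; field; apply/andP.
Qed.

Lemma round_noise_determined t : determined_below t.+1 (round_noise^~ t).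
Proof.
move=> z z' zz'; rewrite /round_noise /mixed_residual zz' ?ltnSn//.
rewrite (decision_at_determined (z := z) (z' := z')) => [//|s st].
exact/zz'/ltnW.
Qed.

Lemma round_noise_put t b z : round_noise (put t b z) t =
  mixed_residual z t * (b%:R - prob z t) / (prob z t * (1 - prob z t)).
Proof. by rewrite /round_noise /mixed_residual decision_at_put put_same. Qed.

(** Given the past, the noise of round [t] is [mixed_residual] times a centred
    variable. *)
Lemma expect_predictable_noise t f : determined_below t f ->
  expect x y D (fun z => f z * round_noise z t) = 0.
Proof.
move=> f_det; rewrite (@expect_average t).
  rewrite -[RHS](expect_cst 0); congr expect; apply/funext => z.
  rewrite /average_at !(determined_below_put _ _ _ f_det)// !round_noise_put /=.
  by ring.
move=> z z' zz'; rewrite (round_noise_determined zz').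
by rewrite (determined_below_le (leqnSn t) f_det zz').
Qed.

Definition round_variance z t : R :=
  mixed_residual z t ^+ 2 / (prob z t * (1 - prob z t)).

Lemma round_variance_ge0 z t : 0 <= round_variance z t.
Proof.
have /andP[p0 p1] := D_proper (history x y z t) (x t).
by rewrite divr_ge0 ?sqr_ge0// mulr_ge0 ?subr_ge0// ltW.
Qed.

Lemma expect_noise_sqr t :
  expect x y D (fun z => round_noise z t ^+ 2)
  = expect x y D (round_variance^~ t).
Proof.
rewrite (@expect_average t); last first.
  by move=> z z' zz'; rewrite (round_noise_determined zz').
congr expect; apply/funext => z; rewrite /average_at !round_noise_put /=.
rewrite /round_variance.
have /andP[p0 p1] := D_proper (history x y z t) (x t).
rewrite -/(decision_at x y D z t) in p0 p1.
have {}p0 : prob z t != 0 by rewrite gt_eqF.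
have {}p1 : 1 - prob z t != 0 by rewrite gt_eqF// subr_gt0.
by field; apply/andP.
Qed.

Lemma expect_noiseM s t : s != t ->
  expect x y D (fun z => round_noise z s * round_noise z t) = 0.
Proof.
wlog st : s t / (s < t)%N => [wlog_st st|_].
  have [lt_st|lt_ts|/val_inj eq_st] := ltngtP s t.
  - exact: wlog_st.
  - under eq_fun do rewrite mulrC.
    by apply: wlog_st => //; rewrite eq_sym.
  - by rewrite eq_st eqxx in st.
apply: expect_predictable_noise.
exact: determined_below_le (@round_noise_determined s).
Qed.

Lemma expect_tau_hat : expect x y D (tau_hat x y D) = average_treatment_effect.
Proof.
have -> : tau_hat x y D =
    fun z => average_treatment_effect + T%:R^-1 * \sum_t round_noise z t.
  exact/funext/tau_hatE.
rewrite expectD expect_cst expectZ expect_sum big1 ?mulr0 ?addr0// => t _.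
rewrite -(@expect_predictable_noise t (fun=> 1))//.
by under [in RHS]eq_fun do rewrite mul1r.
Qed.

Lemma var_tau_hatE : var_tau_hat x y D =
  T%:R ^- 2 * \sum_t expect x y D (round_variance^~ t).
Proof.
rewrite /var_tau_hat /Defs.variance expect_tau_hat.
under eq_fun do rewrite tau_hatE addrC addKr exprMn exprVn [X in _ * X]expr2.
under eq_fun do rewrite mulr_suml.
rewrite expectZ expect_sum; congr (_ * _); apply: eq_bigr => s _.
under eq_fun do rewrite mulr_sumr.
rewrite expect_sum (bigD1 s)//= [X in _ + X]big1 => [|t ts].
  by rewrite addr0 -expect_noise_sqr; under eq_fun do rewrite -expr2.
by rewrite expect_noiseM// eq_sym.
Qed.

Lemma var_tau_hat_ge0 : 0 <= var_tau_hat x y D.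
Proof.
rewrite var_tau_hatE mulr_ge0 ?invr_ge0 ?exprn_ge0//.
apply: sumr_ge0 => t _; rewrite -(expect_cst 0); apply: le_expect => z.
exact: round_variance_ge0.
Qed.

Lemma var_tau_hat_ge t (v : R) : (forall z, v <= round_variance z t) ->
  T%:R ^- 2 * v <= var_tau_hat x y D.
Proof.
move=> v_le; rewrite var_tau_hatE ler_wpM2l ?invr_ge0 ?exprn_ge0//.
rewrite (bigD1 t)//= -[v]addr0 lerD//.
  by rewrite -(expect_cst v); apply: le_expect.
apply: sumr_ge0 => s _; rewrite -(expect_cst 0); apply: le_expect => z.
exact: round_variance_ge0.
Qed.

End Design.

(** * The oracle variance *)

(** The constant design with probability [p] and zero coefficients makes no
    error at all: its [mixed_residual] vanishes in every round. *)
Lemma oracle_variance_le0 (R : realType) (T d : nat) (x : 'I_T -> 'cV[R]_d)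
    (y : 'I_T -> bool -> R) (p : R) :
  0 < p < 1 -> (forall t, (1 - p) * y t true + p * y t false = 0) ->
  oracle_variance x y <= 0.
Proof.
move=> p01 y0.
have const_proper q beta : 0 < q < 1 ->
    proper_design (const_design (T := T) (d := d) q beta) by move=> q01 t h u.
apply: ge_inf.
  exists 0 => _ [q [beta [q01 ->]]]; exact/var_tau_hat_ge0/const_proper.
exists p, (fun=> 0); split=> //.
rewrite var_tau_hatE; last exact: const_proper.
rewrite big1 ?mulr0// => t _.
rewrite -[RHS](expect_cst x y (const_design p (fun=> 0)) 0).
congr expect; apply/funext => z; rewrite /round_variance /mixed_residual /=.
have -> : dotv (x t) 0 = 0 by apply: big1 => i _; rewrite mxE mulr0.
by rewrite !subr0 y0 expr0n mul0r.
Qed.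

(** * Moments and scalar second-moment matrices *)

Lemma powR_ge1 (R : realType) (a e : R) : 1 <= a -> 0 <= e -> 1 <= a `^ e.
Proof. by move=> a1 e0; rewrite -[leLHS](powRr0 a) ler_powR. Qed.

Lemma fourth_root (R : realType) (a : R) : 0 <= a ->
  a `^ 4^-1 = Num.sqrt (Num.sqrt a).
Proof.
move=> a0; rewrite -[Num.sqrt a]powR12_sqrt// -powR12_sqrt ?powR_ge0//.
by rewrite -powRrM; congr (_ `^ _); field.
Qed.

Lemma mean_sqr_le (R : realType) (T : nat) (u : 'I_T -> R) :
  (T%:R^-1 * \sum_t u t) ^+ 2 <= T%:R^-1 * \sum_t u t ^+ 2.
Proof.
case: T u => [|T] u; first by rewrite invr0 !mul0r expr0n.
set m := _ * \sum_t u t.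
have Tn0 : T.+1%:R != 0 :> R by rewrite pnatr_eq0.
have : 0 <= T.+1%:R^-1 * \sum_t (u t - m) ^+ 2.
  by rewrite mulr_ge0 ?invr_ge0// sumr_ge0// => t _; rewrite sqr_ge0.
suff -> : T.+1%:R^-1 * \sum_t (u t - m) ^+ 2
    = T.+1%:R^-1 * \sum_t u t ^+ 2 - m ^+ 2.
  by rewrite subr_ge0.
under eq_bigr do rewrite sqrrB.
rewrite big_split sumrB /= sumr_const card_ord sumrMnl -mulr_suml.
have -> : \sum_t u t = T.+1%:R * m by rewrite /m mulVKf.
rewrite -[m ^+ 2 *+ T.+1]mulr_natl.
by move: (T.+1%:R) Tn0 m => N N0 m; field.
Qed.

(** Zero coefficients already give a residual at most the quadratic mean, which
    is at most the quartic mean. *)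
Lemma min_rms_le_fourth (R : realType) (T d : nat) (x : 'I_T -> 'cV[R]_d)
    (y : 'I_T -> bool -> R) k :
  min_rms_residual x y k <= fourth_moment_norm y k.
Proof.
rewrite /fourth_moment_norm fourth_root; last first.
  by rewrite mulr_ge0 ?invr_ge0// sumr_ge0// => t _; rewrite exprn_even_ge0.
apply: (@le_trans _ _ (Num.sqrt (T%:R^-1 * \sum_t (y t k) ^+ 2))).
  apply: ge_inf; first by exists 0 => _ [beta _ <-]; rewrite sqrtr_ge0.
  exists 0 => //; congr (Num.sqrt (_ * _)); apply: eq_bigr => t _.
  by rewrite /dotv big1 ?subr0// => i _; rewrite mxE mulr0.
rewrite ler_wsqrtr// -[leLHS]ger0_norm; last first.
  by rewrite mulr_ge0 ?invr_ge0// sumr_ge0// => t _; rewrite sqr_ge0.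
rewrite -sqrtr_sqr ler_wsqrtr// (le_trans (mean_sqr_le _))//.
by under eq_bigr do rewrite -exprM.
Qed.

Lemma eigenvalue_scalar (R : realType) (A : 'M[R]_1) (l : R) :
  eigenvalue A l = (l == A 0 0).
Proof.
rewrite [A in LHS]mx11_scalar; apply/eigenvalueP/eqP => [[v]|->].
  rewrite mul_mx_scalar => /eqP; rewrite -subr_eq0 -scalerBl scaler_eq0.
  by case/orP => [|-> //]; rewrite subr_eq0 => /eqP.
by exists 1%:M; [rewrite mul_mx_scalar | rewrite oner_eq0].
Qed.

Lemma sigma_min_scalar_ge (R : realType) (A : 'M[R]_1) (a : R) :
  a <= A 0 0 -> a <= sigma_min A.
Proof.
move=> aA; apply: lb_le_inf.
  exists (Num.sqrt ((A^T *m A) 0 0)), ((A^T *m A) 0 0) => //=.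
  by rewrite eigenvalue_scalar.
move=> _ [l /= + <-]; rewrite eigenvalue_scalar => /eqP->.
by rewrite mxE big_ord1 mxE -expr2 sqrtr_sqr (le_trans aA)// ler_norm.
Qed.

Lemma sum_odd (R : realType) n : \sum_(t < n) (odd t)%:R = (n./2)%:R :> R.
Proof.
rewrite -natr_sum; congr _%:R; elim: n => [|n IHn]; first by rewrite big_ord0.
by rewrite big_ord_recr /= IHn; lia.
Qed.

Lemma sum_even (R : realType) n : \sum_(t < n) (~~ odd t)%:R = (uphalf n)%:R :> R.
Proof.
rewrite -natr_sum; congr _%:R; elim: n => [|n IHn]; first by rewrite big_ord0.
by rewrite big_ord_recr /= IHn; lia.
Qed.

(** * The hard instance *)

(** In terms of [q] the two candidate directions give [2 - 3 q] and [1 - 3 q],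
    which differ by one, so one of them is at least [1/2] in absolute value;
    and [q (1 - q)] is at most [1/4]. *)
Lemma exists_misallocated_direction (R : realType) (q : R) : 0 < q < 1 ->
  exists (w : bool -> R) (p : R),
    [/\ 0 < p < 1, (1 - p) * w true + p * w false = 0,
        forall k, 1 <= w k ^+ 2 <= 4
      & 1 <= ((1 - q) * w true + q * w false) ^+ 2 / (q * (1 - q))].
Proof.
move=> q01; have q_gt0 : 0 < q * (1 - q) by nra.
have [q2|q2] := lerP q 2^-1.
  exists (fun k => if k then 2 else -1), (2 / 3).
  by split; [lra | lra | case; lra | rewrite ler_pdivlMr//; nra].
exists (fun k => if k then 1 else -2), 3^-1.
by split; [lra | lra | case; lra | rewrite ler_pdivlMr//; nra].
Qed.

Section Instance.
Variables (R : realType) (T : nat) (w : bool -> R).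
Hypothesis w_bounds : forall k, 1 <= w k ^+ 2 <= 4.

Definition hard_covariate (t : 'I_T.+1) : 'cV[R]_1 := const_mx (odd t)%:R.

Let r : R := T.+1%:R `^ 4^-1.

Definition hard_outcome (t : 'I_T.+1) (k : bool) : R :=
  (if t == ord0 then r else 1) * w k.

Let r_ge1 : 1 <= r.
Proof. by rewrite powR_ge1// ler1n. Qed.

Let r4 : r ^+ 4 = T.+1%:R.
Proof.
by rewrite /r -powR_mulrn ?powR_ge0// -powRrM mulVf ?pnatr_eq0// powRr1.
Qed.

Let dot_covariate t beta : dotv (hard_covariate t) beta = (odd t)%:R * beta 0 0.
Proof. by rewrite /dotv big_ord1 mxE. Qed.

Let outcome_sqr_ge1 t k : 1 <= hard_outcome t k ^+ 2.
Proof.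
have /andP[w1 _] := w_bounds k; rewrite /hard_outcome exprMn.
by case: ifP => _; rewrite ?expr1n ?mul1r// mulr_ege1// expr_ge1//
  (le_trans _ r_ge1).
Qed.

(** The covariate is zero in the even rounds, at least half of all rounds, and
    there no coefficient can reduce the residual. *)
Lemma hard_residual_ge k :
  2^-1 <= min_rms_residual hard_covariate hard_outcome k.
Proof.
apply: lb_le_inf.
  by eexists; exists 0.
move=> _ [beta _ <-]; set S := \sum_t _.
have S_ge : T.+1%:R / 2 <= S.
  apply: (@le_trans _ _ (\sum_(t < T.+1) (~~ odd t)%:R)).
    by rewrite sum_even ler_pdivrMr// -natrM ler_nat; lia.
  apply: ler_sum => t _; rewrite dot_covariate.
  by case: (odd t) => /=; rewrite ?sqr_ge0// mul0r subr0.
(* The mean square is at least [1/2], hence at least the square of [1/2]. *)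
rewrite -[leLHS]ger0_norm// -sqrtr_sqr ler_wsqrtr//.
apply: (@le_trans _ _ 2^-1); first by lra.
by rewrite mulrC ler_pdivlMr ?ltr0n// mulrC.
Qed.

(** The first outcome, of size at most [2 T^(1/4)], contributes at most [16] to
    the mean fourth power, and so do the other rounds together; and
    [16 + 16 <= 3^4]. *)
Lemma hard_fourth_moment_le k : fourth_moment_norm hard_outcome k <= 3.
Proof.
have w4 : w k ^+ 4 <= 16.
  have /andP[w1 w2] := w_bounds k.
  by rewrite (exprM _ 2 2); nra.
have w4_ge0 : 0 <= w k ^+ 4 by rewrite exprn_even_ge0.
have S_le : T.+1%:R^-1 * \sum_t hard_outcome t k ^+ 4 <= 81.
  rewrite mulrC ler_pdivrMr ?ltr0n//.
  apply: (@le_trans _ _ (\sum_(t < T.+1) ((t == ord0)%:R * (16 * T.+1%:R) + 16))).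
    apply: ler_sum => t _; rewrite /hard_outcome exprMn.
    case: ifP => _ /=; rewrite ?r4 ?expr1n; last by lra.
    have : 0 < T.+1%:R :> R by rewrite ltr0n.
    by move: (T.+1%:R) => N N0; nra.
  rewrite big_split /= -mulr_suml (bigD1 ord0)//= big1 => [|t /negbTE->//].
  rewrite sumr_const card_ord -[16 *+ _]mulr_natr.
  have : 0 < T.+1%:R :> R by rewrite ltr0n.
  by lra.
rewrite /fourth_moment_norm fourth_root; last first.
  by rewrite mulr_ge0 ?invr_ge0// sumr_ge0// => t _; rewrite exprn_even_ge0.
have -> : 3 = Num.sqrt (Num.sqrt 81) :> R.
  have -> : 81 = (3 ^+ 2) ^+ 2 :> R by ring.
  by rewrite sqrtr_sqr ger0_norm ?exprn_ge0// sqrtr_sqr ger0_norm.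
by rewrite !ler_wsqrtr.
Qed.

Lemma hard_assumption1 : assumption1 hard_covariate hard_outcome 2^-1 3.
Proof.
move=> k; split; [exact: hard_residual_ge | exact: min_rms_le_fourth|].
exact: hard_fourth_moment_le.
Qed.

(** Up to round [t] there are [(t + 1)/2] unit covariates, rounded down, which is
    at least a third of the rounds as soon as there are two; the factor [2]
    excludes the very first round, whose covariate is zero. *)
Lemma hard_assumption2 : assumption2 hard_covariate 3 2.
Proof.
move=> t t_ge; apply: sigma_min_scalar_ge.
have t2 : (2 <= t.+1)%N.
  rewrite -(ler_nat R) (le_trans _ t_ge)// ler_peMl//.
  by rewrite powR_ge1// ler1n.
rewrite mxE summxE.
under eq_bigr do rewrite mxE big_ord1 !mxE -natrM mulnb andbb.
have -> : \sum_(s < T.+1 | (s <= t)%N) (odd s)%:R = (t.+1./2)%:R :> R.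
  by rewrite -sum_odd (big_ord_widen T.+1 (fun s => (odd s)%:R)).
by rewrite mulrC ler_pdivlMr ?ltr0n// mulrC ler_pdivrMr// -natrM ler_nat; lia.
Qed.

Lemma hard_max_norm_le1 : max_norm hard_covariate <= 1.
Proof.
rewrite /max_norm; elim/big_ind: _ => // [a b|t _].
  by rewrite ge_max => -> ->.
rewrite /l2norm dot_covariate mxE -natrM mulnb andbb.
by case: (odd t); rewrite ?sqrtr1 ?sqrtr0.
Qed.

Lemma hard_assumption3 : assumption3 hard_covariate 1.
Proof. by rewrite /assumption3 mul1r (le_trans hard_max_norm_le1) ?r_ge1. Qed.

(** Round [0] alone contributes [T * T^(-2) * (T^(1/4))^2 = T^(-1/2)]. *)
Lemma hard_regret_ge (p : R) (D : design R T.+1 1) :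
  proper_design D ->
  0 < p < 1 -> (1 - p) * w true + p * w false = 0 ->
  (let q := treat_prob (D ord0 [tuple] 0) in
    1 <= ((1 - q) * w true + q * w false) ^+ 2 / (q * (1 - q))) ->
  T.+1%:R `^ (- 2^-1) <= neyman_regret hard_covariate hard_outcome D.
Proof.
move=> D_proper p01 p_opt /= q_bad.
have oracle_le0 : oracle_variance hard_covariate hard_outcome <= 0.
  apply: (@oracle_variance_le0 _ _ _ _ _ p) => // t.
  by rewrite /hard_outcome !(mulrCA _ (if _ then _ else _)) -mulrDr p_opt mulr0.
have covariate0 : hard_covariate ord0 = 0.
  by apply/matrixP => i j; rewrite !mxE.
have N0 : 0 < T.+1%:R :> R by rewrite ltr0n.
have var_ge : T.+1%:R ^- 2 * r ^+ 2 <= var_tau_hat hard_covariate hard_outcome D.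
  apply: (@var_tau_hat_ge _ _ _ _ _ _ D_proper ord0) => z.
  rewrite /round_variance /mixed_residual !dot_covariate /= !mul0r !subr0.
  rewrite /decision_at (tuple0 (history _ _ z ord0)) covariate0 /hard_outcome eqxx.
  rewrite !(mulrCA _ r) -mulrDr exprMn -mulrA.
  by rewrite ler_peMr// exprn_ge0// (le_trans _ r_ge1).
apply: (@le_trans _ _ (T.+1%:R * (T.+1%:R ^- 2 * r ^+ 2))); last first.
  rewrite /neyman_regret -[leLHS]subr0 lerB ?ler_wpM2l//.
  by rewrite pmulr_rle0.
have -> : T.+1%:R `^ (- 2^-1) = r ^- 2 :> R.
  rewrite powRN; congr (_^-1); rewrite /r -powR_mulrn ?powR_ge0// -powRrM.
  by congr (_ `^ _); field.
rewrite -r4.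
have : r != 0 by rewrite gt_eqF// (lt_le_trans _ r_ge1).
by move: r => u u0; rewrite le_eqVlt; apply/orP; left; apply/eqP; field.
Qed.

End Instance.

Theorem theorem3p2 (R : realType) :
  exists c0 c1 c2 c3 gamma0 c : R,
    [/\ 0 < c0 <= c1, 0 < c2, 0 < c3, 0 < gamma0 & 0 < c] /\
    forall (T : nat) (D : forall d : nat, design R T d),
      (0 < T)%N ->
      (forall d : nat, (0 < d)%N -> proper_design (D d)) ->
      exists (d : nat) (x : 'I_T -> 'cV[R]_d) (y : 'I_T -> bool -> R),
        [/\ (0 < d)%N,
            assumption1 x y c0 c1,
            assumption2 x c2 gamma0,
            assumption3 x c3
          & c * T%:R `^ (- 2^-1) * max_norm x <= neyman_regret x y (D d)].
Proof.
exists 2^-1, 3, 3, 1, 2, 1; split; first by split; lra.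
case=> // T D _ D_proper.
have D1_proper := D_proper 1%N isT.
have [w [p [p01 p_opt w_bounds q_bad]]] :=
  exists_misallocated_direction (D1_proper ord0 [tuple] 0).
exists 1%N, (@hard_covariate R T), (@hard_outcome R T w); split=> //.
- exact: hard_assumption1.
- exact: hard_assumption2.
- exact: hard_assumption3.
rewrite mul1r (le_trans _ (hard_regret_ge D1_proper p01 p_opt q_bad))//.
by rewrite ler_piMr ?powR_ge0// hard_max_norm_le1.
Qed.
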